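(* Let $m\ge 1$ be an integer. If for some integer $\Delta$ there exists an $m$-$\gamma_t$-critical graph $G$ with $\Delta(G)=\Delta$, $\delta(G)\ge 2$ and order $\Delta+m$, then $m=4$ or $m\ge 3$ is odd. Conversely, suppose $m=4$ or $m\ge 3$ is odd. Then: (1) if $\Delta<2\lfloor\frac{m-1}{2}\rfloor$, there is no $m$-$\gamma_t$-critical graph $G$ with $\Delta(G)=\Delta$, $\delta(G)\ge 2$ and order $\Delta+m$; (2) for every even $\Delta\ge 2\lfloor\frac{m-1}{2}\rfloor$ there exists an $m$-$\gamma_t$-critical graph $G$ with $\Delta(G)=\Delta$, $\delta(G)\ge 2$ and order $\Delta+m$; (3) for every odd $\Delta\ge 2\lfloor\frac{m-1}{2}\rfloor+7$ there exists an $m$-$\gamma_t$-critical graph $G$ with $\Delta(G)=\Delta$, $\delta(G)\ge 2$ and order $\Delta+m$.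
   Context: All graphs are finite and simple. For a graph $G$, $\Delta(G)$ and $\delta(G)$ denote the maximum and minimum degree, and the order is $|V(G)|$. A set $S\subseteq V(G)$ is a total dominating set if every vertex of $G$ (including those in $S$) is adjacent to some vertex of $S$; the total domination number $\gamma_t(G)$ is the minimum size of a total dominating set (defined for graphs without isolated vertices). A leaf is a vertex of degree one. A graph $G$ with no isolated vertex is $\gamma_t$-critical (total domination vertex critical) if for every vertex $v$ of $G$ that is not adjacent to a leaf, $\gamma_t(G-v)<\gamma_t(G)$; it is $m$-$\gamma_t$-critical if moreover $\gamma_t(G)=m$. *)

(* Defs.v *)
From mathcomp Require Import all_boot.
Set Implicit Arguments. Unset Strict Implicit. Unset Printing Implicit Defensive.

Definition simple_graph (T : finType) (e : rel T) : Prop :=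
  symmetric e /\ irreflexive e.

Definition deg (T : finType) (e : rel T) (x : T) : nat := #|[set y | e x y]|.

(* Maximum degree Delta(G) (0 for the empty graph). *)
Definition maxdeg (T : finType) (e : rel T) : nat := \max_(x : T) deg e x.

Definition mindeg_ge (T : finType) (e : rel T) (k : nat) : Prop :=
  forall x : T, k <= deg e x.

Definition tds (T : finType) (e : rel T) (V S : {set T}) : bool :=
  (S \subset V) && [forall x in V, [exists y in S, e x y]].

(* Total domination number of G[V]: the minimum size of a total dominating
   set. (If G[V] has none, i.e. G[V] has an isolated vertex, the value is the
   junk #|T|.+1, larger than any set size.) *)
Definition gamma_t (T : finType) (e : rel T) (V : {set T}) : nat :=
  \big[minn/#|T|.+1]_(S : {set T} | tds e V S) #|S|.

Definition no_isolated (T : finType) (e : rel T) : Prop :=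
  forall x : T, exists y : T, e x y.

Definition adj_to_leaf (T : finType) (e : rel T) (v : T) : Prop :=
  exists y : T, e v y /\ deg e y = 1.

Definition gt_critical (T : finType) (e : rel T) : Prop :=
  no_isolated e /\
  forall v : T, ~ adj_to_leaf e v ->
    gamma_t e (setT :\ v) < gamma_t e setT.

Definition m_gt_critical (m : nat) (T : finType) (e : rel T) : Prop :=
  gt_critical e /\ gamma_t e setT = m.

Definition exists_graph (m D : nat) : Prop :=
  exists (T : finType) (e : rel T),
    [/\ simple_graph e, m_gt_critical m e, maxdeg e = D,
        mindeg_ge e 2 & #|T| = D + m].

(* Main.v *)
(* Let v have maximum degree and S = V \ N[v], so that |S| = m - 1. A smallest
   total dominating set of G - v avoids N[v] and has m - 1 elements, so it is S.
   Trading vertices of S for v, a neighbour of v and a few more vertices, one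
   sees that every x in N(v) has exactly one neighbour f(x) in S and that the
   vertices of S other than f(x) have pairwise disjoint neighbourhoods. Hence
   either G[S] is a perfect matching, f is onto and m - 1 <= Delta, or G[S] is a
   path on three vertices and m = 4.

   Conversely, take a vertex v, a perfect matching or a path a - s - b as S, a
   set N joined to v, a map f from N onto S (onto {a, b} for the path) and a
   graph h on N inside the pairs of fibres over matched vertices (over a and b).
   Criticality reduces to conditions on h in each pair of fibres. They hold for
   K_{r,r} minus a perfect matching and for two graphs on nine vertices, one for
   odd m and one for m = 4, and they survive adding to the two fibres a new
   vertex each, joined to all of the opposite fibre except its twin. *)

Require Import Defs.
From mathcomp Require Import all_boot zify.

Set Implicit Arguments. Unset Strict Implicit. Unset Printing Implicit Defensive.

(** * Total domination: bounds and a criterion for criticality *)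

Lemma tdsP (T : finType) (e : rel T) (V S : {set T}) :
  reflect (S \subset V /\ forall x, x \in V -> exists2 y, y \in S & e x y)
          (tds e V S).
Proof.
apply: (iffP andP) => -[sSV dom]; split=> //.
  by move=> x /(forall_inP dom)/exists_inP.
by apply/forall_inP=> x /dom/exists_inP.
Qed.

Lemma gamma_t_le (T : finType) (e : rel T) (V S : {set T}) :
  tds e V S -> gamma_t e V <= #|S|.
Proof.
move=> tdsS; rewrite /gamma_t.
have: S \in index_enum {set T} by rewrite mem_index_enum.
elim: (index_enum _) => // A r IHr; rewrite inE big_cons => /predU1P[<-|/IHr leS].
  by rewrite tdsS geq_minl.
by case: ifP => // _; rewrite geq_min leS orbT.
Qed.

(** The bound excludes the default value [#|T|.+1] of the minimum. *)
Lemma gamma_t_attained (T : finType) (e : rel T) (V : {set T}) :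
  gamma_t e V <= #|T| -> exists2 S, tds e V S & #|S| = gamma_t e V.
Proof.
rewrite /gamma_t; elim/big_ind: _ => [|m n IHm IHn|S tdsS _]; last by exists S.
  by rewrite ltnn.
by rewrite /minn; case: ifP.
Qed.

Lemma tds_extend (T : finType) (e : rel T) (v w : T) (D : {set T}) :
  e v w -> tds e (setT :\ v) D -> tds e setT (w |: D).
Proof.
move=> evw /tdsP[_ domD]; apply/tdsP; split=> [|x _]; first exact: subsetT.
have [->|x_v] := eqVneq x v; first by exists w; rewrite ?setU11.
have [y yD exy] : exists2 y, y \in D & e x y.
  by apply: domD; rewrite !inE x_v.
by exists y; rewrite // setU1r.
Qed.

(** Adding a neighbour of [v] to a small set for G - v gives the upper bound on [gamma_t]. The
    hypothesis [n < #|T|] keeps the minimum clear of its default, and treating every [v] settles the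
    clause on leaves. *)
Lemma m_gt_criticalI (n : nat) (T : finType) (e : rel T) :
  n < #|T| -> no_isolated e ->
  (forall D, tds e setT D -> n < #|D|) ->
  (forall v, exists2 D, tds e (setT :\ v) D & #|D| <= n) ->
  m_gt_critical n.+1 e.
Proof.
move=> nT noiso big_tds small_tds.
have gammaT : gamma_t e setT = n.+1.
  apply/eqP; rewrite eqn_leq; apply/andP; split.
    have /card_gt0P[v _] : 0 < #|T| by apply: leq_trans nT.
    have [D tdsD cardD] := small_tds v; have [w evw] := noiso v.
    apply: leq_trans (gamma_t_le (tds_extend evw tdsD)) _.
    by rewrite cardsU1; case: (w \notin D); lia.
  rewrite leqNgt; apply/negP=> small; have {}small : gamma_t e setT <= n by lia.
  have [|D tdsD eqD] := @gamma_t_attained _ e setT; first by lia.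
  by have := big_tds D tdsD; lia.
split=> //; split=> // v _; rewrite gammaT ltnS.
by have [D /gamma_t_le leD cardD] := small_tds v; apply: leq_trans leD cardD.
Qed.

(** * Necessity: the structure forced by order Delta + m *)

Lemma cards3_le (T : finType) (a b c : T) : #|[set a; b; c]| <= 3.
Proof. by rewrite -setUA !cardsU1 cards1; do 2!case: (_ \notin _). Qed.

(** Induction on the size: remove a vertex together with its only neighbour in [S]. *)
Lemma even_card_perfect_matching (T : finType) (e : rel T) (S : {set T}) :
  symmetric e -> irreflexive e ->
  (forall s, s \in S -> exists2 t, t \in S & e s t) ->
  (forall s a b, s \in S -> a \in S -> b \in S -> e s a -> e s b -> a = b) ->
  ~~ odd #|S|.
Proof.
move=> sym irr; have [n] := ubnP #|S|; elim: n S => // n IHn S leSn tot uni.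
have [->|[s sS]] := set_0Vmem S; first by rewrite cards0.
have [t tS est] := tot s sS.
have t_s : t != s by apply: contraTneq est => ->; rewrite irr.
have cardS : #|S| = #|S :\: [set s; t]|.+2.
  by rewrite (cardsD1 s) sS (cardsD1 t (S :\ s)) !inE t_s tS setDDl.
rewrite cardS /= negbK; apply: IHn; first by lia.
  move=> a; rewrite !inE negb_or => /andP[/andP[a_s a_t] aS].
  have [b bS eab] := tot a aS; exists b => //; rewrite !inE bS andbT negb_or.
  apply/andP; split; apply/eqP=> eqb; subst b.
    by case/eqP: a_t; apply: (uni s); rewrite // sym.
  by case/eqP: a_s; apply: (uni t); rewrite // sym.
by move=> a b c /setDP[? _] /setDP[? _] /setDP[? _]; apply: uni.
Qed.

(** The bounds on [D], namely 2 for m = 4 and [m - 1] for odd [m], are the values of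
    [2 * (m - 1)./2] below which no graph exists. *)
Lemma critical_order_structure (m D : nat) :
  1 <= m -> exists_graph m D ->
  (m = 4 /\ 2 <= D) \/ [/\ 3 <= m, odd m & m - 1 <= D].
Proof.
move=> m_gt0 [T [e [[sym irr] [[noiso crit] gammaT] maxD deg2 cardT]]].
have [v degv] : exists v, deg e v = D.
  have T_gt0 : 0 < #|T| by lia.
  by have [v dv] := eq_bigmax (deg e) T_gt0; exists v; rewrite -maxD /maxdeg dv.
have degD u : deg e u <= D by rewrite -maxD; exact: (leq_bigmax u).
have D_gt1 : 2 <= D by rewrite -degv deg2.
have ge_m A : tds e setT A -> m <= #|A| by rewrite -gammaT; exact: gamma_t_le.
pose N := [set y | e v y]; pose S := ~: (v |: N).
have cardN : #|N| = D by rewrite -degv.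
have cardS : #|S|.+1 = m.
  have := cardsC (v |: N); rewrite cardsU1 inE irr cardN cardT -/S /=; lia.
have inS s : (s \in S) = (s != v) && ~~ e v s by rewrite !inE negb_or.
have domS u : u != v -> exists2 s, s \in S & e u s.
  have leaf_v : ~ adj_to_leaf e v by case=> y [_ y1]; have := deg2 y; rewrite y1.
  have small := crit v leaf_v; rewrite gammaT in small.
  have [|A tdsA cardA] := @gamma_t_attained _ e (setT :\ v); first by lia.
  have [sAV domA] := tdsP _ _ _ tdsA.
  (* A member of [A] adjacent to [v] would make [A] total dominating in G, with fewer than [m]
     elements. *)
  have sAS : A \subset S.
    apply/subsetP=> a aA; rewrite inS; have := subsetP sAV a aA.
    rewrite !inE => /andP[-> _] /=; apply/negP=> eva.
    have := ge_m _ (tds_extend eva tdsA).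
    by rewrite (setUidPr _) ?sub1set //; lia.
  have [w evw] := noiso v.
  have geA := ge_m _ (tds_extend evw tdsA); rewrite cardsU1 in geA.
  have <- : A = S by apply/eqP; rewrite eqEcard sAS; case: (w \notin A) geA; lia.
  by move=> u_v; apply: domA; rewrite !inE u_v.
(* v dominates N(v) and is dominated by x, so A becomes a total dominating set
   of G once a neighbour of each vertex of S undominated by A is added. *)
have budget x (A : {set T}) : v \in A -> x \in A -> e v x ->
    m <= #|A| + #|[set s in S | ~~ [exists a in A, e s a]]|.
  move=> vA xA evx; set R := [set s in S | _].
  have ex_g u : exists y, e u y by exact: noiso.
  pose g u := xchoose (ex_g u); have eg u : e u (g u) by exact: xchooseP.
  have tdsAg : tds e setT (A :|: g @: R).
    apply/tdsP; split=> [|u _]; first exact: subsetT.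
    have [->|u_v] := eqVneq u v; first by exists x; rewrite ?inE ?xA.
    have [evu|nevu] := boolP (e v u); first by exists v; rewrite ?inE ?vA // sym.
    have [/exists_inP[a aA eua]|nA] := boolP [exists a in A, e u a].
      by exists a; rewrite ?inE ?aA.
    exists (g u) => //; rewrite inE imset_f ?orbT // inE inS u_v nevu.
    exact: nA.
  apply: leq_trans (ge_m _ tdsAg) (leq_trans (leq_card_setU _ _) _).
  by rewrite leq_add2l leq_imset_card.
(* The counted form of [budget]: if [A] dominates [B], at most [#|S| - #|B|] vertices of [S] still
   need a neighbour. *)
have card_rest x (A B : {set T}) : v \in A -> x \in A -> e v x -> B \subset S ->
    (forall s, s \in B -> exists2 a, a \in A & e s a) ->
    m + #|B| <= #|A| + #|S|.
  move=> vA xA evx sBS domB; have := budget x A vA xA evx.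
  have /subset_leq_card : [set s in S | ~~ [exists a in A, e s a]] \subset S :\: B.
    apply/subsetP=> s; rewrite !inE => /andP[-> nA]; rewrite andbT.
    by apply: contra nA => /domB[a aA esa]; apply/exists_inP; exists a.
  rewrite cardsD (setIidPr sBS); have := subset_leq_card sBS; lia.
(* Otherwise {v, x} dominates two vertices of [S], and m + 2 <= 2 + (m - 1). *)
have one_nbr x y y' : e v x -> y \in S -> y' \in S -> e x y -> e x y' -> y = y'.
  move=> evx yS y'S exy exy'; apply/eqP/negPn/negP => y_y'.
  have: m + #|[set y; y']| <= #|[set v; x]| + #|S|.
    apply: (card_rest x); rewrite ?inE ?eqxx ?orbT //.
      by rewrite subUset !sub1set yS.
    by move=> s /set2P[]->; exists x; rewrite ?inE ?eqxx ?orbT // sym.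
  by rewrite !cards2 y_y'; case: (v != x); lia.
(* Otherwise {v, x, c} dominates three vertices of [S], and m + 3 <= 3 + (m - 1). *)
have disj x y a b c : e v x -> y \in S -> e x y -> a \in S -> b \in S ->
    a != y -> b != y -> e a c -> e b c -> a = b.
  move=> evx yS exy aS bS a_y b_y eac ebc; apply/eqP/negPn/negP => a_b.
  have cardB : #|[set a; b; y]| = 3.
    by rewrite -setUA !cardsU1 cards1 !inE negb_or a_b a_y b_y.
  have: m + #|[set a; b; y]| <= #|[set v; x; c]| + #|S|.
    apply: (card_rest x); rewrite ?inE ?eqxx ?orbT //.
      by rewrite !subUset !sub1set aS bS.
    move=> s; rewrite !inE => /orP[/orP[]|] /eqP->; [exists c|exists c|exists x] => //;
      by rewrite ?inE ?eqxx ?orbT // sym.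
  by have := cards3_le v x c; rewrite cardB; lia.
have hit : exists2 x, e v x & exists2 y, y \in S & e x y.
  have [x evx] := noiso v; exists x => //; apply: domS.
  by apply: contraTneq evx => ->; rewrite irr.
(* Otherwise [y] is adjacent to all of [N] and to a vertex of [S], so its degree exceeds [D]. *)
have notall y : y \in S -> exists2 x, e v x & ~~ e x y.
  move=> yS; apply/exists_inP; apply: contraT.
  rewrite negb_exists_in => /forall_inP all_y.
  have [s sS eys] : exists2 s, s \in S & e y s.
    by apply: domS; move: yS; rewrite inS => /andP[].
  have /subset_leq_card : s |: N \subset [set z | e y z].
    rewrite subUset sub1set inE eys; apply/subsetP=> x; rewrite !inE => evx.
    by rewrite sym; have := all_y x evx; rewrite negbK.
  have sN : s \notin N by move: sS; rewrite inS inE => /andP[].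
  by rewrite cardsU1 sN cardN; have := degD y; rewrite /deg; lia.
have two_nbrs u : exists a b, [/\ a != b, e u a & e u b].
  have /card_gt1P[a [b [ua ub a_b]]] := deg2 u.
  by exists a, b; rewrite !inE in ua ub.
(* If some [s] in [S] has two neighbours [a], [b] in [S], then [S] is {a, b, s} and m = 4. *)
have [|match_S] := boolP [exists s in S, exists a in S, exists b in S,
                           [&& a != b, e s a & e s b]].
  case/exists_inP=> s sS /exists_inP[a aS /exists_inP[b bS /and3P[a_b esa esb]]].
  (* By [disj], a common neighbour of [c] and [d] forces every f(x) into {c, d}. *)
  have sub_Y c d t x y : c \in S -> d \in S -> c != d -> e t c -> e t d ->
      e v x -> y \in S -> e x y -> y = c \/ y = d.
    move=> cS dS c_d etc etd evx yS exy.
    have [->|c_y] := eqVneq c y; first by left.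
    have [->|d_y] := eqVneq d y; first by right.
    by case/eqP: c_d; apply: (disj x y c d t); rewrite // sym.
  (* Some [x] in [N] is not adjacent to [d], by [notall]; its neighbour in [S] is then [c]. *)
  have inY c d t : c \in S -> d \in S -> c != d -> e t c -> e t d ->
      exists2 x, e v x & e x c.
    move=> cS dS c_d etc etd; have [x evx nexd] := notall d dS; exists x => //.
    have [y yS exy] : exists2 y, y \in S & e x y.
      by apply: domS; apply: contraTneq evx => ->; rewrite irr.
    have [<- //|eqd] := sub_Y c d t x y cS dS c_d etc etd evx yS exy.
    by rewrite eqd in exy; rewrite exy in nexd.
  have [xa evxa exa] := inY a b s aS bS a_b esa esb.
  have b_a : b != a by rewrite eq_sym.
  have [xb evxb exb] := inY b a s bS aS b_a esb esa.
  left; split=> //.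
  (* A further [t] would have all its neighbours in [S], since f(x) is always [a] or [b]. Two of
     them contain every f(x), so [a] is among them, and [disj] at the common neighbour [a]
     identifies [t] with [s]. *)
  have sub3 : S \subset [set a; b; s].
    apply/subsetP=> t tS; rewrite !inE; apply/negPn/negP.
    rewrite !negb_or -andbA => /and3P[t_a t_b t_s].
    have nbrS c : e t c -> c \in S.
      move=> etc; rewrite inS; apply/andP; split.
        apply: contraTneq etc => ->; rewrite sym.
        by move: tS; rewrite inS => /andP[].
      apply/negP=> evc; rewrite sym in etc.
      have [] := sub_Y a b s c t aS bS a_b esa esb evc tS etc; exact/eqP.
    have [c [d [c_d etc etd]]] := two_nbrs t.
    have eta : e t a.
      have [cS dS] := (nbrS c etc, nbrS d etd).
      by have [->|->] := sub_Y c d t xa a cS dS c_d etc etd evxa aS exa.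
    case/eqP: t_s; apply: (disj xa a t s a) => //.
    by apply: contraTneq esa => ->; rewrite irr.
  have eqS : S = [set a; b; s].
    apply/eqP; rewrite eqEsubset sub3 !subUset !sub1set aS bS sS; done.
  have s_a : a != s by apply: contraTneq esa => ->; rewrite irr.
  have s_b : b != s by apply: contraTneq esb => ->; rewrite irr.
  by rewrite -cardS eqS -setUA !cardsU1 cards1 !inE negb_or a_b s_a s_b.
have uniqS s a b : s \in S -> a \in S -> b \in S -> e s a -> e s b -> a = b.
  move=> sS aS bS esa esb; apply/eqP/negPn/negP => a_b; case/negP: match_S.
  apply/exists_inP; exists s => //; apply/exists_inP; exists a => //.
  by apply/exists_inP; exists b => //; apply/and3P.
have evenS : ~~ odd #|S|.
  apply: (even_card_perfect_matching sym irr) => // s sS.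
  by apply: domS; move: sS; rewrite inS => /andP[].
have S_gt0 : 0 < #|S|.
  by have [x _ [y yS _]] := hit; apply/card_gt0P; exists y.
(* Of two neighbours of [s], neither is [v] and at most one lies in [S]. The implication makes the
   statement total, so that [xchoose] defines a function. *)
have priv s : exists x, (s \in S) ==> e v x && e x s.
  have [sS|_] := boolP (s \in S); last by exists v.
  have [a [b [a_b esa esb]]] := two_nbrs s.
  have nv c : e s c -> c != v.
    move=> esc; apply: contraTneq esc => ->; rewrite sym.
    by move: sS; rewrite inS => /andP[].
  have [eva|neva] := boolP (e v a); first by exists a; rewrite eva sym esa.
  have [evb|nevb] := boolP (e v b); first by exists b; rewrite evb sym esb.
  by case/eqP: a_b; apply: (uniqS s); rewrite // inS nv.
pose g s := xchoose (priv s).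
have gP s : s \in S -> e v (g s) /\ e (g s) s.
  by move=> sS; have /implyP/(_ sS)/andP := xchooseP (priv s).
have g_inj : {in S &, injective g}.
  move=> s t sS tS eqg; have [evs egs] := gP s sS; have [_ egt] := gP t tS.
  by apply: (one_nbr (g s)); rewrite // eqg.
have leSD : #|S| <= D.
  rewrite -(card_in_imset g_inj) -cardN; apply: subset_leq_card.
  by apply/subsetP=> _ /imsetP[s sS ->]; rewrite inE; case: (gP s sS).
right; split; [lia| |lia].
by rewrite -cardS oddS.
Qed.

(** * The hub graph and its degrees *)

Lemma card_option_sum (S N : finType) (P : pred (option (S + N))) :
  #|P| = P None + (#|[pred s | P (Some (inl s))]| + #|[pred x | P (Some (inr x))]|).
Proof.
rewrite (cardD1 None) unfold_in; congr (_ + _).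
rewrite -(card_image (f := fun s : S => Some (inl s) : option (S + N))) => [|s t [] //].
rewrite -(card_image (f := fun x : N => Some (inr x) : option (S + N))) => [|x y [] //].
rewrite -cardUI [X in _ + X]eq_card0 ?addn0; last first.
  by move=> u; rewrite !inE; apply/negP=> /andP[/imageP[s _ ->] /imageP[x _ ]].
apply: eq_card => u; rewrite !inE; apply/idP/orP.
  by case: u => [[s|x]|] //= Pu; [left|right]; apply: map_f; rewrite mem_enum.
by case=> /imageP[s Ps ->].
Qed.

(** [None] is the vertex v of maximum degree, [inl] carries S with its graph [r], and [inr] carries
    N(v); [f x] is the only neighbour of [x] in S. *)
Definition hub_graph (S N : finType) (r : rel S) (f : N -> S) (h : rel N) :
    rel (option (S + N)) :=
  fun u w => match u, w with
  | None, Some (inr _) | Some (inr _), None => true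
  | Some (inl s), Some (inl t) => r s t
  | Some (inl s), Some (inr x) | Some (inr x), Some (inl s) => f x == s
  | Some (inr x), Some (inr y) => h x y
  | _, _ => false
  end.

Section HubGraph.

Variables (S N : finType) (r : rel S) (f : N -> S) (h : rel N).
Let e := hub_graph r f h.

Lemma hub_graph_simple :
  symmetric r -> irreflexive r -> symmetric h -> irreflexive h -> simple_graph e.
Proof.
move=> symr irrr symh irrh; split=> [[[s|x]|] [[t|y]|]|[[s|x]|]] //=;
  by rewrite 1?symr ?irrr 1?symh ?irrh.
Qed.

Lemma hub_graph_deg u : deg e u =
  match u with
  | None => #|N|
  | Some (inl s) => #|[set t | r s t]| + #|[set x | f x == s]|
  | Some (inr x) => #|[set y | h x y]|.+2
  end.
Proof.
rewrite /deg cardsE card_option_sum.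
case: u => [[s|x]|] /=; rewrite ?add0n ?cardsE //.
  by rewrite (@eq_card1 _ (f x)) // => s; rewrite !inE eq_sym.
by rewrite -[RHS]add0n; congr (_ + _); apply: eq_card0.
Qed.

Lemma hub_graph_degrees :
    (forall s, 2 <= #|[set t | r s t]| + #|[set x | f x == s]| <= #|N|) ->
    (forall x, #|[set y | h x y]|.+2 <= #|N|) -> 2 <= #|N| ->
  maxdeg e = #|N| /\ mindeg_ge e 2.
Proof.
move=> degS degN N_gt1; split=> [|u]; last first.
  by rewrite hub_graph_deg; case: u => [[s|x]|] //; case/andP: (degS s).
apply/eqP; rewrite eqn_leq; apply/andP; split.
  apply/bigmax_leqP=> u _; rewrite hub_graph_deg.
  by case: u => [[s|x]|] //; case/andP: (degS s).
by rewrite -(hub_graph_deg None); apply: (@leq_bigmax _ (deg e) None).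
Qed.

End HubGraph.

(** * Matched labels and gadgets *)

(** The partner in the perfect matching on S for odd m; for m = 4 it exchanges the two ends of the
    path. *)
Definition mate (I : eqType) (s : I * bool) : I * bool := (s.1, ~~ s.2).

Lemma mateK (I : eqType) : involutive (@mate I).
Proof. by case=> i c; rewrite /mate /= negbK. Qed.

Lemma mate_neq (I : eqType) (s : I * bool) : mate s != s.
Proof. by case: s => i []; rewrite /mate xpair_eqE /= andbF. Qed.

Lemma same_fst_mate (I : eqType) (s t : I * bool) :
  s.1 = t.1 -> s = t \/ s = mate t.
Proof.
case: s t => i c [j d] /= <-; rewrite /mate /=.
by case: c d => [] []; [left|right|right|left].
Qed.

(* The fibres over (i, true) and (i, false) form the i-th gadget. gad_miss1 and
   gad_miss2 prevent total dominating sets of size m - 1; gad_single provides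
   one of G - x, containing q, or p and q. The key says what p and q must (fail
   to) dominate: all of the gadget (key = fst) for odd m, but only one fibre
   (key = id) for m = 4, where one of a and b is available to dominate the
   other fibre. *)
Record gadgets (I N : finType) (K : Type) (key : I * bool -> K)
    (f : N -> I * bool) (h : rel N) : Prop := Gadgets {
  gad_sym : symmetric h;
  gad_irr : irreflexive h;
  gad_local : forall x y, h x y -> (f x).1 = (f y).1;
  gad_miss1 : forall p, exists2 y, f y = mate (f p) & ~~ h p y;
  gad_miss2 : forall p q, f q = mate (f p) ->
    exists y, [/\ key (f y) = key (f p), ~~ h p y & ~~ h q y];
  gad_single : forall x, exists2 q, f q = mate (f x) &
    (forall y, f y = f x -> y != x -> h y q) \/
    exists p, [/\ f p = f x, p != x &
      forall y, key (f y) = key (f x) -> y != x -> h y p || h y q]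
}.

(** * Enlarging gadgets by pairs of twins *)

Section Extension.

Variables (I B P : finType) (K : Type) (key : I * bool -> K).
Variables (f0 : B -> I * bool) (h0 : rel B) (g : P -> I).
Hypothesis key_fst : forall s t, key s = key t -> s.1 = t.1.
Hypothesis base : gadgets key f0 h0.

Definition ext_label (x : B + P * bool) : I * bool :=
  match x with inl b => f0 b | inr p => (g p.1, p.2) end.

(** The twins [(p, true)] and [(p, false)] have opposite labels, and [p.1 != q.1] keeps them
    nonadjacent. Over an empty base each gadget becomes K_{r,r} minus a perfect matching. *)
Definition ext_rel : rel (B + P * bool) := fun x y =>
  match x, y with
  | inl b, inl b' => h0 b b'
  | inr p, inr q => (ext_label y == mate (ext_label x)) && (p.1 != q.1)
  | _, _ => ext_label y == mate (ext_label x)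
  end.

Lemma eq_mate_sym (s t : I * bool) : (t == mate s) = (s == mate t).
Proof. by apply/eqP/eqP=> ->; rewrite mateK. Qed.

Lemma ext_rel_same x y : ext_label x = ext_label y ->
  ext_rel x y = if (x, y) is (inl b, inl b') then h0 b b' else false.
Proof.
move=> eqxy; have ne := negPf (mate_neq (ext_label y)).
by case: x y eqxy ne => [b|p] [b'|q] //= ->; rewrite eq_sym => ->.
Qed.

(** The twin of a new vertex is missed by it but adjacent to the rest of its fibre, which gives
    [gad_miss1] and [gad_single] for new vertices. *)
Lemma extend_gadgets : gadgets key ext_label ext_rel.
Proof.
have nsame p y : ext_label (inr p) = ext_label y -> ~~ ext_rel (inr p) y.
  by move/ext_rel_same->.
have nsame' p y : ext_label y = ext_label (inr p) -> ~~ ext_rel y (inr p).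
  by move/ext_rel_same->; case: y.
have ntwin i c d : ~~ ext_rel (inr (i, c)) (inr (i, d)) by rewrite /= eqxx andbF.
split.
- move=> [b|p] [b'|q] /=; [exact: (gad_sym base)| | |];
    by rewrite eq_mate_sym // [q.1 == _]eq_sym.
- by move=> [b|p] /=; rewrite ?(gad_irr base) // eqxx andbF.
- move=> [b|p] [b'|q] /=; first exact: gad_local base _ _.
  + by move/eqP/(congr1 fst).
  + by move/eqP/(congr1 fst).
  + by case/andP=> /eqP/(congr1 fst).
- move=> [b|[i c]]; last by exists (inr (i, ~~ c)).
  by have [y] := gad_miss1 base b; exists (inl y).
(* Unless both vertices are old, take the missed vertex in the fibre of the first: the twin of the
   second if that is new, else the one from [gad_miss1]. A new vertex has no neighbour in its own
   fibre. *)
- move=> [b|[i c]] [b'|[j d]] eqf.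
  + by have [y [? ? ?]] := gad_miss2 base eqf; exists (inl y).
  + exists (inr (j, ~~ d)); have eqb : ext_label (inr (j, ~~ d)) = ext_label (inl b).
      by rewrite -[RHS]mateK -eqf.
    by rewrite eqb; split=> //; apply: nsame'.
  + have [y fy nby] := gad_miss1 base b'; exists (inl y).
    have eqy : ext_label (inl y) = ext_label (inr (i, c)).
      by rewrite /= fy -/(ext_label (inl b')) eqf mateK.
    by rewrite eqy; split=> //; apply: nsame.
  + exists (inr (j, ~~ d)).
    have eqb : ext_label (inr (j, ~~ d)) = ext_label (inr (i, c)).
      by rewrite -[RHS]mateK -eqf.
    by rewrite eqb; split=> //; apply: nsame.
- move=> [b|[i c]]; last first.
    exists (inr (i, ~~ c)) => //; left=> -[b|[j d]] /= fy.
      by move=> _; rewrite fy.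
    by case: fy => -> -> ne; rewrite eqxx /=; apply: contra ne => /eqP->.
  (* The base witnesses still work: a new vertex in the fibre of [b] is adjacent to [q], and one in
     the opposite fibre to [p]. *)
  have [q fq dom] := gad_single base b; exists (inl q) => //.
  case: dom => [dom|[p [fp p_b dom]]]; [left|right].
    move=> [y|y] fy ne; first by apply: dom.
    by rewrite /= in fy *; rewrite fq fy.
  exists (inl p); split=> // -[y|y] fy ne; first by apply: dom.
  have [eqf|eqf] := same_fst_mate (key_fst fy).
    by rewrite /= in eqf *; rewrite fq eqf eqxx orbT.
  by rewrite /= in eqf *; rewrite fp eqf mateK eqxx.
Qed.

End Extension.

(** [x] is adjacent neither to itself nor to the vertex from [gad_miss1]. *)
Lemma gadgets_degree (I N : finType) (K : Type) (key : I * bool -> K)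
    (f : N -> I * bool) (h : rel N) (x : N) :
  gadgets key f h -> #|[set y | h x y]|.+2 <= #|N|.
Proof.
move=> gad; have [y fy nxy] := gad_miss1 gad x.
have x_y : x != y by apply: contraTneq (mate_neq (f x)) => eqxy; rewrite -fy eqxy eqxx.
have /subset_leq_card : [set z | h x z] \subset ~: [set x; y].
  apply/subsetP=> z; rewrite !inE negb_or => xz.
  by apply/andP; split; apply: contraTneq xz => ->; rewrite ?(gad_irr gad).
by have := cardsC [set x; y]; rewrite cards2 x_y; lia.
Qed.

(** One edge inside S is added to the fibre, so these bounds put the degree of [s] between 2 and
    [#|N|]. *)
Lemma fiber_bounds (I N : finType) (f : N -> I * bool) (s : I * bool) :
  (forall t, exists x, f x = t) -> 0 < #|[set x | f x == s]| < #|N|.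
Proof.
move=> surj; have [x fx] := surj s; have [y fy] := surj (mate s).
apply/andP; split; first by apply/card_gt0P; exists x; rewrite inE fx.
rewrite -cardsT; apply: proper_card; apply/properP; split; first exact: subsetT.
by exists y; rewrite ?inE // fy mate_neq.
Qed.

Lemma setT_D1P (T : finType) (u v : T) : (u \in setT :\ v) = (u != v).
Proof. by rewrite !inE andbT. Qed.

(** * Odd m: the hub graph over a perfect matching *)

Section OddCase.

Variables (I N : finType) (f : N -> I * bool) (h : rel N).
Hypotheses (I_gt0 : 0 < #|I|) (surj : forall s, exists x, f x = s).
Hypothesis gad : gadgets fst f h.

Let r (s t : I * bool) := t == mate s.
Let e := hub_graph r f h.
Let hS (s : I * bool) : option (I * bool + N) := Some (inl s).
Let hN (x : N) : option (I * bool + N) := Some (inr x).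

(** If [D] has at most |S| elements, [phi] maps it bijectively onto S. The dominator [x] of v and
    the member [d] of [D] over [mate (f x)] then leave a vertex of their gadget undominated, by
    [gad_miss1] or [gad_miss2]. *)
Lemma odd_hub_tds_gt D : tds e setT D -> #|{: I * bool}| < #|D|.
Proof.
case/tdsP=> _ dom; rewrite ltnNge; apply/negP=> leD.
(* The index only supplies a value of [phi] at v, which [D] turns out to avoid. *)
have /card_gt0P[i0 _] := I_gt0.
(* The vertices w with phi w = s, apart from v, are the neighbours of hS s, so D
   meets each fibre of phi exactly once. *)
pose phi (u : option (I * bool + N)) :=
  match u with None => (i0, true) | Some (inl s) => mate s | Some (inr x) => f x end.
have hit s : exists2 d, d \in D :\ None & phi d = s.
  have [[[t|x]|] dD //= est] := dom (hS s) (in_setT _).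
    by exists (hS t); rewrite ?inE //= (eqP est) mateK.
  by exists (hN x); rewrite ?inE //=; apply/eqP.
have leSphi : #|{: I * bool}| <= #|phi @: (D :\ None)|.
  rewrite -cardsT; apply: subset_leq_card; apply/subsetP=> s _.
  by have [d dD <-] := hit s; apply: imset_f.
have lephi := leq_imset_card phi (D :\ None).
have cardD := cardsD1 None D.
have noneD : None \notin D.
  apply/negP=> inD; have := leq_trans leD (leq_trans leSphi lephi).
  by rewrite cardD inD ltnn.
have inj : {in D &, injective phi}.
  have eqD : D :\ None = D by apply/setDidPl; rewrite disjoint_sym disjoints1.
  rewrite eqD in leSphi lephi.
  by apply/imset_injP; rewrite eqn_leq lephi (leq_trans leD leSphi).
have [[[t|x]|] xD //= _] := dom None (in_setT _).
have nmate : hS (mate (f x)) \notin D.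
  by apply/negP=> sD; have := inj _ _ sD xD; rewrite /= mateK => /(_ erefl).
have [d /setD1P[_ dD] phid] := hit (mate (f x)).
(* In this gadget [D] meets N only in [x] and perhaps [d]; a [y] missed by them is left to
   [hS (f y)]. *)
have escape y : (f y).1 = (f x).1 -> ~~ h x y ->
    (forall q, d = hN q -> ~~ h q y) -> hS (f y) \in D.
  move=> fy nxy ndy.
  have [[[t|z]|] zD /= eyz] := dom (hN y) (in_setT _).
  - by rewrite (eqP eyz).
  - have fz : (f z).1 = (f x).1 by rewrite -fy (gad_local gad eyz).
    rewrite (gad_sym gad) in eyz.
    have [eqf|eqf] := same_fst_mate fz.
      have [eqz] := inj _ _ zD xD eqf.
      by rewrite -eqz eyz in nxy.
    have eqd : d = hN z by apply: inj; rewrite // phid -eqf.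
    by rewrite (negPf (ndy z eqd)) in eyz.
  - by rewrite zD in noneD.
case: d dD phid escape => [[t|q]|] dD /= phid escape; last by rewrite dD in noneD.
  have [y fy nxy] := gad_miss1 gad x.
  by have /negP[] := nmate; rewrite -fy; apply: escape; rewrite ?fy.
have [y [fy nxy nqy]] := gad_miss2 gad phid.
have fyD : hS (f y) \in D by apply: escape => // _ [<-].
have [eqf|eqf] := same_fst_mate fy; last by rewrite -eqf fyD in nmate.
by have := inj _ _ fyD dD; rewrite /= eqf phid => /(_ erefl).
Qed.

Lemma odd_hub_tds_le v :
  exists2 D, tds e (setT :\ v) D & #|D| <= #|{: I * bool}|.
Proof.
case: v => [[s|x]|].
- have [x fx] := surj (mate s).
  (* Starting from S, trade [s] and [mate s] for v and a vertex over [mate s]. *)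
  exists (None |: (hN x |: hS @: ~: [set s; mate s])).
    apply/tdsP; split.
      apply/subsetP=> u; rewrite setT_D1P !inE => /orP[/eqP->|/orP[/eqP->|]] //.
      case/imsetP=> t; rewrite !inE negb_or => /andP[t_s _] ->.
      by apply: contraNneq t_s => -[->].
    move=> [[t|y]|]; rewrite setT_D1P => u_s.
    + have [->|t_ms] := eqVneq t (mate s).
        by exists (hN x); rewrite ?inE ?eqxx //= fx.
      exists (hS (mate t)); last exact: eqxx.
      do 2!apply: setU1r; apply: imset_f; rewrite !inE negb_or.
      rewrite eq_sym -eq_mate_sym t_ms (inj_eq (can_inj (@mateK I))).
      by apply: contraNneq u_s => ->.
    + by exists None; rewrite ?inE.
    + by exists (hN x); rewrite ?inE ?eqxx.
  rewrite -[leqRHS](cardsC [set s; mate s]) cards2 eq_sym mate_neq !cardsU1 addnA.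
  by apply: leq_add; [do 2!case: (_ \notin _) | apply: leq_imset_card].
(* A partial transversal [P] of the fibres is completed by [hS (mate t)] for each fibre [t] that it
   misses, at most |S| elements in all. A vertex [y] is left to [P] when [hS (f y)] is not
   chosen. *)
- have cover (P : {set N}) q : x \notin P -> {in P &, injective f} -> q \in P ->
      (forall p, p \in P -> (f p).1 = (f x).1) -> mate (f x) \in f @: P ->
      (forall y, mate (f y) \in f @: P -> y != x -> exists2 p, p \in P & h y p) ->
      exists2 D, tds e (setT :\ hN x) D & #|D| <= #|{: I * bool}|.
    move=> xP inj qP loc mP dom.
    exists ((hN @: P) :|: [set hS (mate t) | t in ~: f @: P]).
      apply/tdsP; split.
        apply/subsetP=> u; rewrite setT_D1P inE => /orP[]/imsetP[t tP ->] //.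
        by apply: contraNneq xP => -[<-].
      move=> [[t|y]|]; rewrite setT_D1P => u_x.
      + have [/imsetP[p pP eqt]|tP] := boolP (t \in f @: P).
          by exists (hN p); rewrite ?inE ?imset_f //= eqt.
        exists (hS (mate t)); rewrite /= /r ?eqxx // inE; apply/orP; right.
        by apply: imset_f; rewrite inE.
      + have [/dom[|p pP eyp]|yP] := boolP (mate (f y) \in f @: P).
        * by apply: contraNneq u_x => ->.
        * by exists (hN p); rewrite // inE imset_f.
        * exists (hS (f y)); rewrite /= ?eqxx // inE; apply/orP; right.
          by apply/imsetP; exists (mate (f y)); rewrite ?inE ?mateK.
      + by exists (hN q); rewrite // inE imset_f.
    apply: leq_trans (leq_card_setU _ _) _.
    apply: leq_trans (leq_add (leq_imset_card _ _) (leq_imset_card _ _)) _.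
    by rewrite -(card_in_imset inj) cardsC.
  have [q fq dom] := gad_single gad x.
  have q_x : q != x by apply: contraTneq (mate_neq (f x)) => eqx; rewrite -fq eqx eqxx.
  case: dom => [dom|[p [fp p_x dom]]].
    apply: (cover [set q] q); rewrite ?inE // 1?eq_sym //.
    + by move=> a b /set1P-> /set1P->.
    + by move=> _ /set1P->; rewrite fq.
    + by rewrite imset_set1 fq inE.
    + move=> y; rewrite imset_set1 inE fq (inj_eq (can_inj (@mateK I))) => /eqP fy y_x.
      by exists q; rewrite ?inE //; apply: dom.
  apply: (cover [set p; q] q); rewrite ?inE ?eqxx ?orbT //.
  + by rewrite negb_or eq_sym p_x eq_sym q_x.
  + have ne := mate_neq (f x).
    by move=> a b /set2P[]-> /set2P[]-> //; rewrite fp fq => eqm; case/eqP: ne.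
  + by move=> _ /set2P[]->; rewrite ?fp ?fq.
  + by rewrite -fq imset_f // !inE eqxx orbT.
  + move=> y /imsetP[a aP eqy] y_x.
    have /orP[yp|yq] : h y p || h y q.
    * apply: dom => //; rewrite -[LHS]/((mate (f y)).1) eqy.
      by case/set2P: aP => ->; rewrite ?fp ?fq.
    * by exists p; rewrite ?inE ?eqxx.
    * by exists q; rewrite ?inE ?eqxx ?orbT.
exists (hS @: setT); last by rewrite -[leqRHS]cardsT leq_imset_card.
apply/tdsP; split; first by apply/subsetP=> _ /imsetP[s _ ->]; rewrite !inE.
move=> [[s|x]|]; rewrite setT_D1P // => _.
  by exists (hS (mate s)); rewrite ?imset_f //= /r.
by exists (hS (f x)); rewrite ?imset_f //=.
Qed.

Lemma odd_hub_graph : exists_graph (2 * #|I|).+1 #|N|.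
Proof.
have N_gt1 : 1 < #|N|.
  have /card_gt0P[i _] := I_gt0; have /andP[] := fiber_bounds (i, true) surj; lia.
have simple : simple_graph e.
  apply: hub_graph_simple (gad_sym gad) (gad_irr gad).
    exact: eq_mate_sym.
  by move=> s; rewrite /r eq_sym; apply/negbTE/mate_neq.
have cardV : #|{: option (I * bool + N)}| = (2 * #|I| + #|N|).+1.
  by rewrite card_option card_sum card_prod card_bool mulnC.
have [maxD min2] : maxdeg e = #|N| /\ mindeg_ge e 2.
  apply: hub_graph_degrees => // [s|x]; last exact: gadgets_degree gad.
  have -> : #|[set t | r s t]| = 1.
    by rewrite -(cards1 (mate s)); apply: eq_card => t; rewrite !inE.
  by rewrite add1n ltnS; apply: fiber_bounds.
exists (option (I * bool + N)), e; split=> //; last by rewrite cardV; lia.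
have cardS : #|{: I * bool}| = 2 * #|I| by rewrite card_prod card_bool mulnC.
rewrite -cardS; apply: m_gt_criticalI.
- by rewrite cardS cardV; lia.
- move=> u; have /card_gt0P[w] : 0 < deg e u by apply: leq_trans (min2 u).
  by rewrite inE; exists w.
- exact: odd_hub_tds_gt.
- exact: odd_hub_tds_le.
Qed.

End OddCase.

(** * The case m = 4: the hub graph over a path *)

Section FourCase.

Variables (N : finType) (f : N -> unit * bool) (h : rel N).
Hypotheses (surj : forall s, exists x, f x = s) (gad : gadgets id f h).

(** The path a - s - b, with [None] as its middle vertex. *)
Let r (s t : option (unit * bool)) := (s == None) != (t == None).
Let e := hub_graph r (Some \o f) h.
Let hM : option (option (unit * bool) + N) := Some (inl None).
Let hS s : option (option (unit * bool) + N) := Some (inl (Some s)).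
Let hN x : option (option (unit * bool) + N) := Some (inr x).

Let same_or_mate (s t : unit * bool) : s = t \/ s = mate t.
Proof. by apply: same_fst_mate; case: s t => [[] ?] [[] ?]. Qed.

(** The middle needs an end [s] in [D], and the hub needs some [x] of N. With only one more element,
    some vertex over [mate s] stays undominated. *)
Lemma four_hub_tds_gt D : tds e setT D -> 3 < #|D|.
Proof.
case/tdsP=> _ dom; rewrite ltnNge; apply/negP=> leD.
have [s sD] : exists s, hS s \in D.
  by have [[[[s|]|x]|] // sD _] := dom hM (in_setT _); exists s.
have [x xD] : exists x, hN x \in D.
  by have [[[t|x]|] // xD _] := dom None (in_setT _); exists x.
have hitS t : hM \in D \/ exists2 y, hN y \in D & f y = t.
  have [[[[t'|]|y]|] // yD /= ety] := dom (hS t) (in_setT _); first by left.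
  by right; exists y; rewrite //; apply/eqP.
have domN y : f y = mate s -> 
      [\/ exists2 z, hN z \in D & h y z, hS (mate s) \in D | None \in D].
  move=> fy; have [[[[t|]|z]|] zD //= eyz] := dom (hN y) (in_setT _).
  - by apply: Or32; have [eqt] := eqP eyz; rewrite -fy eqt.
  - by apply: Or31; exists z.
  - by apply: Or33.
have only (A : {set _}) : #|A| = 3 -> A \subset D -> D = A.
  by move=> cA sAD; apply/eqP; rewrite eq_sym eqEcard sAD cA.
have s_m : mate s != s := mate_neq s.
(* The two ends are dominated by the middle or by one vertex of N over each; [gad_miss1] serves the
   first case and [gad_miss2] the second. *)
have [MD|MD] := boolP (hM \in D).
  have eqD : D = [set hM; hS s; hN x].
    by apply: only; rewrite ?subUset ?sub1set ?MD ?sD ?xD // -setUA !cardsU1 cards1 !inE.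
  have [y fy nxy] : exists2 y, f y = mate s & ~~ h x y.
    have [fx|fx] := same_or_mate (f x) s; first by rewrite -fx; apply: (gad_miss1 gad).
    by exists x; rewrite ?(gad_irr gad).
  case: (domN y fy) => [[z]||]; rewrite eqD !inE //=.
    by case/eqP=> ->; rewrite (gad_sym gad) (negPf nxy).
  by case/orP=> /eqP[] // eqm; rewrite eqm eqxx in s_m.
have hit t : exists2 y, hN y \in D & f y = t.
  by have [MD'|//] := hitS t; rewrite MD' in MD.
have [x1 x1D fx1] := hit s; have [x2 x2D fx2] := hit (mate s).
have x12 : x1 != x2 by apply: contraNneq s_m => eqx; rewrite -fx2 -eqx fx1.
have eqD : D = [set hS s; hN x1; hN x2].
  apply: only; rewrite ?subUset ?sub1set ?x1D ?sD ?x2D // -setUA !cardsU1 cards1 !inE.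
  by rewrite /= -[hN x1 == _]/(x1 == x2) x12.
have [y [fy n2y n1y]] : exists y, [/\ f y = f x2, ~~ h x2 y & ~~ h x1 y].
  by apply: (gad_miss2 gad); rewrite fx1 fx2 mateK.
rewrite fx2 in fy; case: (domN y fy) => [[z]||]; rewrite eqD !inE //=.
  by case/orP=> /eqP[->]; rewrite (gad_sym gad) ?(negPf n1y) ?(negPf n2y).
by case/orP=> [/orP[]|] /eqP[] // eqm; rewrite eqm eqxx in s_m.
Qed.

Lemma four_hub_tds_le v : exists2 D, tds e (setT :\ v) D & #|D| <= 3.
Proof.
case: v => [[[s|]|x]|].
- have [y fy] := surj (mate s).
  exists [set None; hN y; hS (mate s)]; last exact: cards3_le.
  apply/tdsP; split.
    rewrite !subUset !sub1set !setT_D1P /=; apply: contraNneq (mate_neq s) => -[->] //.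
  move=> [[[t|]|z]|]; rewrite setT_D1P => ne.
  + exists (hN y); rewrite ?inE ?eqxx ?orbT //= fy.
    by have [eqt|->] := same_or_mate t s; first by rewrite eqt eqxx in ne.
  + by exists (hS (mate s)); rewrite ?inE ?eqxx ?orbT.
  + by exists None; rewrite ?inE.
  + by exists (hN y); rewrite ?inE ?eqxx ?orbT.
- have [x fx] := surj (tt, true); have [y fy] := surj (tt, false).
  exists [set None; hN x; hN y]; last exact: cards3_le.
  apply/tdsP; split; first by rewrite !subUset !sub1set !setT_D1P.
  move=> [[[[[] []]|]|z]|]; rewrite setT_D1P // => _.
  + by exists (hN x); rewrite ?inE ?eqxx ?orbT //= fx.
  + by exists (hN y); rewrite ?inE ?eqxx ?orbT //= fy.
  + by exists None; rewrite ?inE.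
  + by exists (hN x); rewrite ?inE ?eqxx ?orbT.
(* [hS (mate (f x))] dominates its own fibre and the middle, so only the fibre of [x] is left to
   [q], or to [p] and [q]. *)
- have [q fq dom] := gad_single gad x.
  have q_x : q != x by apply: contraTneq (mate_neq (f x)) => eqx; rewrite -fq eqx eqxx.
  case: dom => [dom|[p [fp p_x dom]]].
    exists [set hM; hN q; hS (mate (f x))]; last exact: cards3_le.
    apply/tdsP; split.
      by rewrite !subUset !sub1set !setT_D1P /= andbT; apply: contraNneq q_x => -[->].
    move=> [[[t|]|y]|]; rewrite setT_D1P // => ne.
    + by exists hM; rewrite ?inE ?eqxx.
    + by exists (hS (mate (f x))); rewrite ?inE ?eqxx ?orbT.
    + have [fy|fy] := same_or_mate (f y) (f x).
        by exists (hN q); rewrite ?inE ?eqxx ?orbT //=; apply: dom.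
      by exists (hS (mate (f x))); rewrite ?inE ?eqxx ?orbT //= fy.
    + by exists (hN q); rewrite ?inE ?eqxx ?orbT.
  exists [set hN p; hN q; hS (mate (f x))]; last exact: cards3_le.
  apply/tdsP; split.
    rewrite !subUset !sub1set !setT_D1P /= andbT; apply/andP; split.
      by apply: contraNneq p_x => -[->].
    by apply: contraNneq q_x => -[->].
  move=> [[[t|]|y]|]; rewrite setT_D1P // => ne.
  + have [->|->] := same_or_mate t (f x).
      by exists (hN p); rewrite ?inE ?eqxx //= fp.
    by exists (hN q); rewrite ?inE ?eqxx ?orbT //= fq.
  + by exists (hS (mate (f x))); rewrite ?inE ?eqxx ?orbT.
  + have [fy|fy] := same_or_mate (f y) (f x); last first.
      by exists (hS (mate (f x))); rewrite ?inE ?eqxx ?orbT //= fy.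
    have /orP[yp|yq] : h y p || h y q.
    * exact: dom.
    * by exists (hN p); rewrite ?inE ?eqxx.
    * by exists (hN q); rewrite ?inE ?eqxx ?orbT.
  + by exists (hN q); rewrite ?inE ?eqxx ?orbT.
- exists [set hM; hS (tt, true); hS (tt, false)]; last exact: cards3_le.
  apply/tdsP; split; first by rewrite !subUset !sub1set !setT_D1P.
  move=> [[[t|]|y]|]; rewrite setT_D1P // => _.
  + by exists hM; rewrite ?inE ?eqxx.
  + by exists (hS (tt, true)); rewrite ?inE ?eqxx ?orbT.
  + exists (hS (f y)); rewrite ?inE //=.
    by case: (f y) => [[] []]; rewrite eqxx ?orbT.
Qed.

Lemma four_hub_graph : exists_graph 4 #|N|.
Proof.
have fib s := fiber_bounds s surj.
have N_gt1 : 1 < #|N| by have /andP[] := fib (tt, true); lia.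
have simple : simple_graph e.
  apply: hub_graph_simple (gad_sym gad) (gad_irr gad).
    by move=> s t; rewrite /r eq_sym.
  by move=> s; rewrite /r eqxx.
have cardV : #|{: option (option (unit * bool) + N)}| = #|N| + 4.
  by rewrite card_option card_sum card_option card_prod card_unit card_bool mul1n; lia.
have [maxD min2] : maxdeg e = #|N| /\ mindeg_ge e 2.
  apply: hub_graph_degrees => // [[s|]|x]; last exact: gadgets_degree gad.
    have -> : #|[set t | r (Some s) t]| = 1.
      rewrite -(cards1 (None : option (unit * bool))).
      by apply: eq_card => -[t|]; rewrite !inE.
    rewrite add1n ltnS.
    have -> : #|[set x | (Some \o f) x == Some s]| = #|[set x | f x == s]|.
      by apply: eq_card => x; rewrite !inE.
    exact: fib.
  have -> : #|[set t | r None t]| = 2.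
    have <- : #|[set Some (tt, true); Some (tt, false)]| = 2 by rewrite cards2.
    by apply: eq_card => -[[[] []]|]; rewrite !inE.
  by rewrite [X in _ + X]eq_card0 // => x; rewrite !inE.
exists (option (option (unit * bool) + N)), e; split=> //.
apply: m_gt_criticalI.
- by rewrite cardV; lia.
- move=> u; have /card_gt0P[w] : 0 < deg e u by apply: leq_trans (min2 u).
  by rewrite inE; exists w.
- exact: four_hub_tds_gt.
- exact: four_hub_tds_le.
Qed.

End FourCase.

(** * Gadgets on nine vertices, checked by computation *)

Lemma all_iotaP (n : nat) (P : pred nat) :
  reflect (forall i : 'I_n, P i) (all P (iota 0 n)).
Proof.
apply: (iffP allP) => [allP i|allP i]; first by apply: allP; rewrite mem_iota /=.
by rewrite mem_iota /= => lti; have := allP (Ordinal lti).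
Qed.

Lemma has_iotaP (n : nat) (P : pred nat) :
  reflect (exists i : 'I_n, P i) (has P (iota 0 n)).
Proof.
apply: (iffP hasP) => [[i]|[i Pi]]; last by exists (val i); rewrite ?mem_iota /=.
by rewrite mem_iota /= => lti Pi; exists (Ordinal lti).
Qed.

Section NineVertices.

Variables (E : seq (nat * nat)) (full : bool).

Definition nine_rel (i j : nat) : bool := ((i, j) \in E) || ((j, i) \in E).
(** Fibres of five and four vertices; the odd total makes Delta odd. *)
Definition nine_side (i : nat) : bool := i < 5.

Let all9 (P : pred nat) : bool := all P (iota 0 9).
Let has9 (P : pred nat) : bool := has P (iota 0 9).
Let near (x y : nat) : bool := full || (nine_side y == nine_side x).

(* full selects key = fst (true) or key = id (false) in gadgets. *)
Definition nine_check : bool :=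
  [&& all9 (fun x => ~~ nine_rel x x),
      all9 (fun p => has9 (fun y =>
        (nine_side y == ~~ nine_side p) && ~~ nine_rel p y)),
      all9 (fun p => all9 (fun q => (nine_side q == ~~ nine_side p) ==>
        has9 (fun y => [&& near p y, ~~ nine_rel p y & ~~ nine_rel q y]))) &
      all9 (fun x => has9 (fun q => (nine_side q == ~~ nine_side x) &&
        (all9 (fun y => (nine_side y == nine_side x) ==> (y != x) ==> nine_rel y q)
         || has9 (fun p => [&& nine_side p == nine_side x, p != x &
              all9 (fun y => near x y ==> (y != x) ==> nine_rel y p || nine_rel y q)]))))].

(** A single index makes [gad_local] trivial, and [nine_rel] is symmetric by construction. The other
    fields are the four clauses of [nine_check], stated over [iota] so that they evaluate. *)
Lemma nine_gadgets (I : finType) (i0 : I) (K : Type) (key : I * bool -> K) :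
  (forall c d, key (i0, c) = key (i0, d) <-> full || (c == d)) -> nine_check ->
  gadgets key (fun b : 'I_9 => (i0, nine_side b)) (fun b b' => nine_rel b b').
Proof.
move=> keyP /and4P[/all_iotaP irr /all_iotaP miss1 /all_iotaP miss2 /all_iotaP single].
split=> //.
- by move=> x y; rewrite /nine_rel orbC.
- by move=> x; apply/negbTE.
- move=> p; have /has_iotaP[y /andP[/eqP sy ny]] := miss1 p.
  by exists y; rewrite // sy.
- move=> p q [sq]; have /all_iotaP/(_ q) := miss2 p.
  rewrite sq eqxx => /has_iotaP[y /and3P[sy np nq]]; exists y; split=> //.
  exact/keyP.
- move=> x; have /has_iotaP[q /andP[/eqP sq dom]] := single x.
  exists q; first by rewrite sq.
  case/orP: dom => [/all_iotaP dom|/has_iotaP[p /and3P[/eqP sp p_x /all_iotaP dom]]].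
    by left=> y [sy] y_x; have := dom y; rewrite sy eqxx => /implyP/(_ isT)/implyP; apply.
  right; exists p; split; rewrite ?sp // => y /keyP sy y_x.
  by have /implyP/(_ sy)/implyP := dom y; apply.
Qed.

End NineVertices.

(* Both edge lists were found by simulated annealing. *)
Definition edges_odd : seq (nat * nat) :=
  [:: (0, 1); (0, 2); (1, 3); (2, 3); (0, 4); (1, 4); (3, 4); (1, 5); (1, 6);
      (2, 6); (3, 6); (5, 6); (0, 7); (1, 7); (2, 7); (4, 7); (6, 7); (0, 8);
      (2, 8); (3, 8); (4, 8); (5, 8)].
Definition edges_four : seq (nat * nat) :=
  [:: (0, 2); (1, 2); (1, 3); (2, 4); (3, 4); (3, 5); (1, 6); (2, 6); (4, 6);
      (5, 6); (0, 7); (1, 7); (0, 8); (3, 8); (4, 8); (7, 8)].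

Lemma edges_odd_check : nine_check edges_odd true. Proof. by vm_compute. Qed.
Lemma edges_four_check : nine_check edges_four false. Proof. by vm_compute. Qed.

(** * The families of graphs and the theorem *)

(** The empty base for even Delta: all of N comes from the extension. *)
Lemma void_gadgets (I : finType) (K : Type) (key : I * bool -> K) :
  gadgets key (of_void (I * bool)) (fun _ _ => false).
Proof. by split=> // -[]. Qed.

(** The capped map sends pair [p] to gadget [p] and every surplus pair to gadget [k]. *)
Lemma inord_minn_onto (k d : nat) (i : 'I_k.+1) :
  i < d -> exists p : 'I_d, inord (minn p k) = i :> 'I_k.+1.
Proof.
move=> ltid; exists (Ordinal ltid); apply: val_inj.
by rewrite /= (minn_idPl (ltn_ord i : i <= k)) inordK.
Qed.

(** Each of the [k.+1] gadgets needs a pair of twins, whence [k < d]. *)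
Lemma odd_even_graph (k d : nat) : k < d -> exists_graph (2 * k.+1).+1 (2 * d).
Proof.
move=> ltkd; pose g (p : 'I_d) : 'I_k.+1 := inord (minn p k).
have gad := extend_gadgets g (fun _ _ => id) (void_gadgets (I := 'I_k.+1) fst).
have surj s : exists x, ext_label (of_void _) g x = s.
  case: s => i c; have [|p gp] := @inord_minn_onto k d i.
    exact: leq_trans (ltn_ord i) ltkd.
  by exists (inr (p, c)); rewrite /= /g gp.
have I_gt0 : 0 < #|'I_k.+1| by rewrite card_ord.
have := odd_hub_graph I_gt0 surj gad.
by rewrite card_sum card_prod card_bool !card_ord card_void add0n [d * 2]mulnC.
Qed.

(** The nine-vertex base occupies gadget [k], so [k] pairs suffice for the others. The least Delta
    is thus 2k + 9 = (m - 1) + 7. *)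
Lemma odd_odd_graph (k d : nat) :
  k <= d -> exists_graph (2 * k.+1).+1 (2 * d + 9).
Proof.
move=> lekd; pose g (p : 'I_d) : 'I_k.+1 := inord (minn p k).
have keyP (c b : bool) :
    (ord_max : 'I_k.+1, c).1 = (ord_max : 'I_k.+1, b).1 <-> true || (c == b).
  by [].
have gad := extend_gadgets g (fun _ _ => id) (nine_gadgets keyP edges_odd_check).
have surj s : exists x, ext_label (fun b : 'I_9 => (ord_max, nine_side b)) g x = s.
  case: s => i c; have [ltik|geik] := ltnP i k.
    have [p gp] := inord_minn_onto (leq_trans ltik lekd).
    by exists (inr (p, c)); rewrite /= /g gp.
  have -> : i = ord_max by apply/val_inj/eqP; rewrite eqn_leq geik -ltnS ltn_ord.
  (* 0 and 5 are the first vertices of the two sides. *)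
  by exists (inl (inord (if c then 0 else 5))); rewrite /= inordK; case: c.
have I_gt0 : 0 < #|'I_k.+1| by rewrite card_ord.
have := odd_hub_graph I_gt0 surj gad.
by rewrite card_sum card_prod card_bool !card_ord addnC [d * 2]mulnC.
Qed.

Lemma four_even_graph (d : nat) : 0 < d -> exists_graph 4 (2 * d).
Proof.
move=> d_gt0; pose g (p : 'I_d) := tt.
have gad := extend_gadgets (key := id) g (fun _ _ => @congr1 _ _ fst _ _)
  (void_gadgets (I := unit) id).
have surj s : exists x, ext_label (of_void _) g x = s.
  by case: s => -[] c; exists (inr (Ordinal d_gt0, c)).
have := four_hub_graph surj gad; rewrite card_sum card_prod card_bool !card_ord.
by rewrite card_void add0n mulnC.
Qed.

Lemma four_odd_graph (d : nat) : exists_graph 4 (2 * d + 9).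
Proof.
pose g (p : 'I_d) := tt.
have keyP (c b : bool) : id (tt, c) = id (tt, b) <-> false || (c == b).
  by split=> [[->]|/eqP->]; rewrite ?eqxx.
have base := nine_gadgets (key := id) keyP edges_four_check.
have gad := extend_gadgets (key := id) g (fun _ _ => @congr1 _ _ fst _ _) base.
have surj s : exists x, ext_label (fun b : 'I_9 => (tt, nine_side b)) g x = s.
  case: s => -[] c; exists (inl (inord (if c then 0 else 5))).
  by rewrite /= inordK; case: c.
have := four_hub_graph surj gad; rewrite card_sum card_prod card_bool !card_ord.
by rewrite addnC mulnC.
Qed.

Theorem theorem2 (m : nat) (hm : 1 <= m) :
  ((exists D : nat, exists_graph m D) -> m = 4 \/ (3 <= m /\ odd m)) /\
  ((m = 4 \/ (3 <= m /\ odd m)) ->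
     [/\ (forall D : nat, D < 2 * (m - 1)./2 -> ~ exists_graph m D),
         (forall D : nat, ~~ odd D -> 2 * (m - 1)./2 <= D -> exists_graph m D)
       & (forall D : nat, odd D -> 2 * (m - 1)./2 + 7 <= D -> exists_graph m D)]).
Proof.
split=> [[D /(critical_order_structure hm)[[]|[]]]|]; [by left | by right |].
case=> [->|[m_ge3 odd_m]].
  split=> D => [ltD /(@critical_order_structure 4 D isT)|evenD geD|oddD geD].
  - by move=> [[_]|[]] //; rewrite /= in ltD; lia.
  - have -> : D = 2 * D./2 by lia.
    by apply: four_even_graph; rewrite /= in geD; lia.
  (* For m = 4 the bound is 2 + 7 = 9, the size of the base alone. *)
  - have -> : D = 2 * (D - 9)./2 + 9 by rewrite /= in geD; lia.
    exact: four_odd_graph.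
(* [k.+1] is half of m - 1, the number of matched pairs in S. *)
have [k eqm] : exists k, m = (2 * k.+1).+1 by exists (m - 3)./2; lia.
split=> D => [ltD /(critical_order_structure hm)|evenD geD|oddD geD].
- by move=> [[]|[]]; lia.
- have -> : D = 2 * D./2 by lia.
  by rewrite eqm; apply: odd_even_graph; lia.
- have -> : D = 2 * (D - 9)./2 + 9 by lia.
  by rewrite eqm; apply: odd_odd_graph; lia.
Qed.
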